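(* Let $n,p\ge 1$, $\lambda\ge 0$, and let $\Sigma$ be an $n$-dimensional complete (without boundary) $\lambda$-submanifold properly immersed in the Gauss space $\mathbb G^{n+p}$. Let $P$ be a hyperplane in $\mathbb G^{n+p}$ such that $d(O,P)=\lambda$, where $O$ is the origin. If $\Sigma$ lies in the side of $P$ not containing the origin (that is, in a closed half-space bounded by $P$ whose interior does not contain $O$), then $\Sigma\subset P$.
   Context: The Gauss space $\mathbb G^m$ is $\mathbb R^m$ with its Euclidean metric and the density $e^{-f}=(2\pi)^{-m/2}e^{-|X|^2/2}$, where $X$ is the position vector. For an $n$-dimensional submanifold $\Sigma$ of $\mathbb G^{n+p}$, $\mathbf H$ denotes the mean curvature vector (the trace of the second fundamental form, not divided by $n$), $X^\perp$ the component of $X$ normal to $\Sigma$, and $\mathbf H_f=\mathbf H+X^\perp$ the weighted mean curvature vector. $\Sigma$ is a $\lambda$-submanifold if $|\mathbf H_f|=\lambda$ on $\Sigma$ for a constant $\lambda\ge 0$. $d(O,P)$ is the Euclidean distance. *)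

(* Defs.v *)
From HB Require Import structures.
From mathcomp Require Export all_boot all_order all_algebra.
From mathcomp Require Export all_classical all_reals all_analysis.
Export numFieldNormedType.Exports.
Export Order.TTheory GRing.Theory Num.Theory.
Set Implicit Arguments.
Unset Strict Implicit.
Unset Printing Implicit Defensive.
Local Open Scope classical_set_scope.
Local Open Scope ring_scope.

(* The library norm on 'rV[R]_m is the sup norm: it gives the topology and the
   differential calculus of R^m, but all metric notions go through [enorm]. *)
Definition dot (R : realType) (m : nat) (u v : 'rV[R]_m) : R :=
  (u *m v^T) 0 0.
Definition enorm (R : realType) (m : nat) (u : 'rV[R]_m) : R :=
  Num.sqrt (dot u u).
Definition edist_to (R : realType) (m : nat) (x : 'rV[R]_m)
    (P : set 'rV[R]_m) : R :=
  inf [set enorm (x - y) | y in P].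

Definition hyperplane_of (R : realType) (m : nat) (nu : 'rV[R]_m) (b : R) :
  set 'rV[R]_m := [set x | dot x nu = b].
Definition halfspace_of (R : realType) (m : nat) (nu : 'rV[R]_m) (b : R) :
  set 'rV[R]_m := [set x | b <= dot x nu].
Definition is_hyperplane (R : realType) (m : nat) (P : set 'rV[R]_m) : Prop :=
  exists nu b, nu != 0 /\ P = hyperplane_of nu b.
(* Both sides of P arise, since (nu, b) and (- nu, - b) define the same
   hyperplane. *)
Definition closed_halfspace_bounded_by (R : realType) (m : nat)
    (S P : set 'rV[R]_m) : Prop :=
  exists nu b, [/\ nu != 0, P = hyperplane_of nu b & S = halfspace_of nu b].

(* Maps are total; only the values on the open set U matter. *)
Fixpoint Ck_on (R : realType) (V W : normedModType R) (k : nat) (U : set V)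
    (f : V -> W) : Prop :=
  match k with
  | 0%N => forall x, U x -> {for x, continuous f}
  | k'.+1 => (forall x, U x -> differentiable f x) /\
             (forall v, Ck_on k' U (fun x => 'D_v f x))
  end.
Definition smooth_on (R : realType) (V W : normedModType R) (U : set V)
    (f : V -> W) : Prop :=
  forall k, Ck_on k U f.

(* Homeomorphism from an open subset of M onto an open subset of R^n (hence no
   boundary); cmap and cinv are arbitrary outside these open sets. *)
Record chart (R : realType) (n : nat) (M : topologicalType) : Type := Chart {
  cdom : set M;
  cmap : M -> 'rV[R]_n;
  cinv : 'rV[R]_n -> M;
  cdom_open : open cdom;
  cimg_open : open (cmap @` cdom);
  cmapK : forall q, cdom q -> cinv (cmap q) = q;
  cmap_continuous : forall q, cdom q -> {for q, continuous cmap};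
  cinv_continuous : forall x, (cmap @` cdom) x -> {for x, continuous cinv}
}.

Definition cimg (R : realType) (n : nat) (M : topologicalType)
  (c : chart R n M) : set 'rV[R]_n := cmap c @` cdom c.

Record smooth_manifold_structure (R : realType) (n : nat)
    (M : topologicalType) : Type := SmoothManifoldStructure {
  atlas : set (chart R n M);
  atlas_cover : forall q, exists2 c, atlas c & cdom c q;
  atlas_compatible : forall c1 c2, atlas c1 -> atlas c2 ->
    smooth_on (cmap c1 @` (cdom c1 `&` cdom c2)) (cmap c2 \o cinv c1);
  manifold_hausdorff : hausdorff_space M;
  manifold_second_countable : @second_countable M
}.

Definition local_param (R : realType) (n m : nat) (M : topologicalType)
    (c : chart R n M) (F : M -> 'rV[R]_m) : 'rV[R]_n -> 'rV[R]_m :=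
  F \o cinv c.

Definition smooth_map (R : realType) (n m : nat) (M : topologicalType)
    (A : smooth_manifold_structure R n M) (F : M -> 'rV[R]_m) : Prop :=
  forall c, atlas A c -> smooth_on (cimg c) (local_param c F).

(* Row i of the Jacobian 'J Y x is the i-th partial derivative of Y at x, so
   row freeness is injectivity of the differential. *)
Definition immersion (R : realType) (n m : nat) (M : topologicalType)
    (A : smooth_manifold_structure R n M) (F : M -> 'rV[R]_m) : Prop :=
  smooth_map A F /\
  (forall c q, atlas A c -> cdom c q ->
     row_free ('J (local_param c F) (cmap c q))).

Definition proper_map (R : realType) (m : nat) (M : topologicalType)
    (F : M -> 'rV[R]_m) : Prop :=
  forall K, compact K -> compact (F @^-1` K).

Definition first_fundamental_form (R : realType) (n m : nat)
    (Y : 'rV[R]_n -> 'rV[R]_m) (x : 'rV[R]_n) : 'M[R]_n :=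
  'J Y x *m ('J Y x)^T.

(* Orthogonal projection onto the row space of 'J Y x:
   v |-> \sum_(i, j) g^(ij) <v, Y_i> Y_j. *)
Definition tangent_part (R : realType) (n m : nat)
    (Y : 'rV[R]_n -> 'rV[R]_m) (x : 'rV[R]_n) (v : 'rV[R]_m) : 'rV[R]_m :=
  v *m ('J Y x)^T *m invmx (first_fundamental_form Y x) *m 'J Y x.
Definition normal_part (R : realType) (n m : nat)
    (Y : 'rV[R]_n -> 'rV[R]_m) (x : 'rV[R]_n) (v : 'rV[R]_m) : 'rV[R]_m :=
  v - tangent_part Y x v.

Definition second_fundamental_form (R : realType) (n m : nat)
    (Y : 'rV[R]_n -> 'rV[R]_m) (x : 'rV[R]_n) (i j : 'I_n) : 'rV[R]_m :=
  normal_part Y x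
    ('D_(delta_mx 0 i) (fun y => 'D_(delta_mx 0 j) Y y) x).

Definition mean_curvature_vector (R : realType) (n m : nat)
    (Y : 'rV[R]_n -> 'rV[R]_m) (x : 'rV[R]_n) : 'rV[R]_m :=
  \sum_(i < n) \sum_(j < n)
    (invmx (first_fundamental_form Y x)) i j *: second_fundamental_form Y x i j.

(* For the Gauss density e^(-f), f is |X|^2 / 2 up to a constant, so that the
   normal part of its gradient is that of the position vector. *)
Definition weighted_mean_curvature_vector (R : realType) (n m : nat)
    (Y : 'rV[R]_n -> 'rV[R]_m) (x : 'rV[R]_n) : 'rV[R]_m :=
  mean_curvature_vector Y x + normal_part Y x (Y x).

(* The weighted mean curvature vector does not depend on the chart. *)
Definition lambda_submanifold (R : realType) (n m : nat) (M : topologicalType)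
    (A : smooth_manifold_structure R n M) (F : M -> 'rV[R]_m)
    (lambda : R) : Prop :=
  forall c q, atlas A c -> cdom c q ->
    enorm (weighted_mean_curvature_vector (local_param c F) (cmap c q))
    = lambda.

(* C^1 on an open neighbourhood of [0, 1]. Corners need not be allowed: a
   piecewise C^1 curve becomes C^1, with the same length, once reparametrized
   so as to stop at its corners. *)
Definition C1_curve (R : realType) (n : nat) (M : topologicalType)
    (A : smooth_manifold_structure R n M) (g : R -> M) : Prop :=
  exists U : set R, [/\ open U, `[0, 1] `<=` U,
    (forall t, U t -> {for t, continuous g}) &
    forall c, atlas A c -> Ck_on 1 (U `&` g @^-1` cdom c) (cmap c \o g)].

(* Length for the metric that F pulls back from R^m. *)
Definition curve_length (R : realType) (m : nat) (M : topologicalType)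
    (F : M -> 'rV[R]_m) (g : R -> M) : \bar R :=
  (\int[lebesgue_measure]_(t in `[0%R, 1%R]) (enorm (derive1 (F \o g) t))%:E)%E.

(* +oo between distinct components *)
Definition riemannian_dist (R : realType) (n m : nat) (M : topologicalType)
    (A : smooth_manifold_structure R n M) (F : M -> 'rV[R]_m)
    (q r : M) : \bar R :=
  ereal_inf [set curve_length F g |
              g in [set g | [/\ C1_curve A g, g 0 = q & g 1 = r]]].

Definition complete_immersed (R : realType) (n m : nat) (M : topologicalType)
    (A : smooth_manifold_structure R n M) (F : M -> 'rV[R]_m) : Prop :=
  forall u : nat -> M,
    (forall e : R, 0 < e -> exists N : nat, forall i j : nat,
        (N <= i)%N -> (N <= j)%N ->
        (riemannian_dist A F (u i) (u j) < e%:E)%E) ->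
    exists q : M, forall e : R, 0 < e -> exists N : nat, forall i : nat,
        (N <= i)%N -> (riemannian_dist A F (u i) q < e%:E)%E.

(* Main.v *)
(* In local coordinates the weighted mean curvature vector is
   tr_g D^2 Y + Y - D_B Y for a continuous vector field B (the drift), so the
   height function w = <F, nu> - lambda, nonnegative on Sigma, satisfies
   L w = <H_f, nu> - lambda - w <= - w for the drift Laplacian
   L = tr_g D^2 - D_B. By the strong maximum principle {w = 0} is open, hence
   N = {w > 0} is open and closed. If N were nonempty then, F being proper,
   w + eps |F|^2 would attain its minimum on N, and at such a point
   0 <= L (w + eps |F|^2) <= - w + 2 eps (n + lambda |F| - |F|^2). So |F| is
   bounded there independently of eps and w = O(eps), whereas w has a positive
   minimum on the part of N lying in a fixed ball. *)
Require Import Defs.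
From mathcomp Require Import ring lra.
Set Implicit Arguments.
Unset Strict Implicit.
Unset Printing Implicit Defensive.
Local Open Scope classical_set_scope.
Local Open Scope ring_scope.

(** * The Euclidean inner product and matrix-valued limits *)

Section dot.
Context {R : realType} {m : nat}.
Implicit Types (u v w : 'rV[R]_m) (k : R).

Lemma dotE u v : dot u v = \sum_i u 0 i * v 0 i.
Proof. by rewrite /dot !mxE; apply: eq_bigr => i _; rewrite !mxE. Qed.

Lemma dotC u v : dot u v = dot v u.
Proof. by rewrite !dotE; apply: eq_bigr => i _; rewrite mulrC. Qed.

Lemma dotDl u v w : dot (u + v) w = dot u w + dot v w.
Proof. by rewrite /dot mulmxDl mxE. Qed.

Lemma dotDr u v w : dot w (u + v) = dot w u + dot w v.
Proof. by rewrite dotC dotDl !(dotC w). Qed.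

Lemma dotNl u v : dot (- u) v = - dot u v.
Proof. by rewrite /dot mulNmx mxE. Qed.

Lemma dotNr u v : dot u (- v) = - dot u v.
Proof. by rewrite dotC dotNl dotC. Qed.

Lemma dotZl k u v : dot (k *: u) v = k * dot u v.
Proof. by rewrite /dot -scalemxAl mxE. Qed.

Lemma dotZr k u v : dot u (k *: v) = k * dot u v.
Proof. by rewrite dotC dotZl dotC. Qed.

Lemma dot0l u : dot 0 u = 0.
Proof. by rewrite /dot mul0mx mxE. Qed.

Lemma dot0r u : dot u 0 = 0.
Proof. by rewrite dotC dot0l. Qed.

Lemma dot_suml (I : finType) (f : I -> 'rV[R]_m) u :
  dot (\sum_i f i) u = \sum_i dot (f i) u.
Proof. by rewrite /dot mulmx_suml summxE. Qed.

Lemma dotuu_ge0 u : 0 <= dot u u.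
Proof. by rewrite dotE sumr_ge0// => i _; rewrite -expr2 sqr_ge0. Qed.

Lemma sqr_coord_le_dot u i : u 0 i ^+ 2 <= dot u u.
Proof.
rewrite dotE (bigD1 i)//= -expr2 lerDl sumr_ge0// => j _.
by rewrite -expr2 sqr_ge0.
Qed.

Lemma dotuu_eq0 u : (dot u u == 0) = (u == 0).
Proof.
apply/eqP/eqP => [u0|->]; last exact: dot0l.
apply/rowP => i; rewrite mxE; apply/eqP; rewrite -sqrf_eq0.
by rewrite eq_le sqr_ge0 andbT -u0 sqr_coord_le_dot.
Qed.

Lemma dotuu_gt0 u : (0 < dot u u) = (u != 0).
Proof. by rewrite lt_neqAle dotuu_ge0 andbT eq_sym dotuu_eq0. Qed.

Lemma enorm_ge0 u : 0 <= enorm u.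
Proof. exact: sqrtr_ge0. Qed.

Lemma sqr_enorm u : enorm u ^+ 2 = dot u u.
Proof. by rewrite sqr_sqrtr// dotuu_ge0. Qed.

(** Cauchy-Schwarz: the squared length of [dot v v *: u - dot u v *: v] is [dot v v] times the
    difference of the two sides. *)
Lemma dot_sqr_le u v : dot u v ^+ 2 <= dot u u * dot v v.
Proof.
have [->|v0] := eqVneq v 0; first by rewrite !dot0r expr0n mulr0.
have vv : 0 < dot v v by rewrite dotuu_gt0.
have := dotuu_ge0 (dot v v *: u - dot u v *: v).
rewrite !(dotDl, dotDr, dotNl, dotNr, dotZl, dotZr) (dotC v u).
move=> h; suff : 0 <= dot v v * (dot u u * dot v v - dot u v ^+ 2).
  by rewrite pmulr_rge0// subr_ge0.
by move: h; rewrite -(pmulr_rge0 _ vv); nra.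
Qed.

Lemma norm_dot_le_enorm u v : `|dot u v| <= enorm u * enorm v.
Proof.
rewrite -(@ler_pXn2r _ 2)// ?nnegrE ?mulr_ge0 ?enorm_ge0//.
by rewrite exprMn !sqr_enorm real_normK ?num_real// dot_sqr_le.
Qed.

Lemma dot_le_enorm u v : dot u v <= enorm u * enorm v.
Proof. exact: le_trans (ler_norm _) (norm_dot_le_enorm u v). Qed.

Lemma enormN u : enorm (- u) = enorm u.
Proof. by rewrite /enorm dotNl dotNr opprK. Qed.

Lemma norm_le_enorm u : `|u| <= enorm u.
Proof.
rewrite [leLHS]/Num.Def.normr/= mx_normrE; apply: bigmax_le => [|[i j] _ /=].
  exact: enorm_ge0.
rewrite ord1 -(@ler_pXn2r _ 2)// ?nnegrE ?enorm_ge0//.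
by rewrite sqr_enorm real_normK ?num_real// sqr_coord_le_dot.
Qed.

End dot.

Section matrix_continuity.
Context {R : realType} {T : Type} (F : set_system T) {FF : Filter F}.

Lemma cvg_mxP (m n : nat) (f : T -> 'M[R]_(m, n)) (L : 'M[R]_(m, n)) :
  f @ F --> L <-> forall i j, f x i j @[x --> F] --> L i j.
Proof.
split=> [fL i j|fL A [P PL sPA]].
  exact: (cvg_comp _ _ fL (@coord_continuous _ _ _ i j L)).
have : \forall x \near F, forall ij : 'I_m * 'I_n, P ij.1 ij.2 (f x ij.1 ij.2).
  by apply: filter_forall => -[i j]; apply: (fL i j); exact: PL.
by apply: filterS => x Px; apply: sPA => i j; exact: (Px (i, j)).
Qed.

Lemma cvg_coord (m n : nat) (f : T -> 'M[R]_(m, n)) (L : 'M[R]_(m, n)) i j :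
  f @ F --> L -> f x i j @[x --> F] --> L i j.
Proof. by move=> fL; have [+ _] := cvg_mxP f L; exact. Qed.

Lemma cvg_sum (V : normedModType R) (I : finType) (f : I -> T -> V) (l : I -> V) :
  (forall i, f i @ F --> l i) -> (\sum_i f i x) @[x --> F] --> \sum_i l i.
Proof. by move=> fl; apply: cvg_big => [|i _]; [exact: add_continuous|exact: fl]. Qed.

Lemma cvg_mulmx (m n p : nat) (f : T -> 'M[R]_(m, n)) (g : T -> 'M[R]_(n, p))
    (A : 'M[R]_(m, n)) (B : 'M[R]_(n, p)) :
  f @ F --> A -> g @ F --> B -> (f x *m g x) @[x --> F] --> A *m B.
Proof.
move=> /cvg_mxP fA /cvg_mxP gB; apply/cvg_mxP => i j.
rewrite mxE; under eq_cvg do rewrite mxE.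
by apply: cvg_big => [|k _]; [exact: add_continuous|exact: cvgM].
Qed.

Lemma cvg_trmx (m n : nat) (f : T -> 'M[R]_(m, n)) (A : 'M[R]_(m, n)) :
  f @ F --> A -> (f x)^T @[x --> F] --> A^T.
Proof.
move=> /cvg_mxP fA; apply/cvg_mxP => i j.
by rewrite mxE; under eq_cvg do rewrite mxE; exact: fA.
Qed.

Lemma cvg_row (m n : nat) (f : T -> 'M[R]_(m, n)) (A : 'M[R]_(m, n)) i :
  f @ F --> A -> row i (f x) @[x --> F] --> row i A.
Proof.
move=> fA; rewrite rowE; under eq_cvg do rewrite rowE.
exact (cvg_mulmx (cvg_cst _) fA).
Qed.

Lemma cvg_det (n : nat) (f : T -> 'M[R]_n) (A : 'M[R]_n) :
  f @ F --> A -> \det (f x) @[x --> F] --> \det A.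
Proof.
move=> /cvg_mxP fA; apply: cvg_big => [|s _]; first exact: add_continuous.
apply: cvgM; first exact: cvg_cst.
by apply: cvg_big => [|i _]; [exact: mul_continuous|exact: fA].
Qed.

(** Cramer's rule: the inverse is the adjugate over the determinant, and both are polynomial in the
    entries. *)
Lemma cvg_invmx (n : nat) (f : T -> 'M[R]_n) (A : 'M[R]_n) :
  A \in unitmx -> f @ F --> A -> invmx (f x) @[x --> F] --> invmx A.
Proof.
move=> uA fA; have dA := cvg_det fA.
have dA0 : \det A != 0 by rewrite -unitfE.
have : ((\det (f x))^-1 *: \adj (f x)) @[x --> F] --> invmx A.
  rewrite /invmx uA; apply/cvg_mxP => i j.
  rewrite mxE; under eq_cvg do rewrite mxE.
  apply: cvgM; first exact: cvgV.
  rewrite !mxE; under eq_cvg do rewrite mxE.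
  apply: cvgM; first exact: cvg_cst.
  apply: cvg_det; apply/cvg_mxP => k l.
  by rewrite !mxE; under eq_cvg do rewrite !mxE; exact: (cvg_mxP _ _).1.
apply: cvg_trans; apply: near_eq_cvg.
(* Cramer's formula describes [invmx] only at invertible matrices (elsewhere [invmx] returns its
   argument), hence the restriction to nonzero determinants. *)
have : \forall x \near F, \det (f x) != 0.
  exact: (cvgr_neq0 _ dA dA0).
by apply: filterS => x fx0; rewrite /invmx unitmxE unitfE fx0.
Qed.

Lemma cvg_dot (m : nat) (f g : T -> 'rV[R]_m) (u v : 'rV[R]_m) :
  f @ F --> u -> g @ F --> v -> dot (f x) (g x) @[x --> F] --> dot u v.
Proof.
by move=> fu gv; apply: (cvg_mxP _ _).1; apply: cvg_mulmx => //; exact: cvg_trmx.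
Qed.

End matrix_continuity.
Arguments cvg_coord {R T F FF m n f L} i j _.

(** * Directional derivatives and the second derivative test *)

Lemma is_derive_coord (R : realType) (V : normedModType R) (m n : nat)
    (f : V -> 'M[R]_(m, n)) (x v : V) (df : 'M[R]_(m, n)) i j :
  is_derive x v f df -> is_derive x v (fun y => f y i j) (df i j).
Proof.
move=> [dfx <-]; apply: DeriveDef; first by have [+ _] := derivable_mxP f x v; exact.
by rewrite (derive_mx dfx) mxE.
Qed.

Lemma is_derive_dot (R : realType) (V : normedModType R) (m : nat)
    (f g : V -> 'rV[R]_m) (x v : V) (df dg : 'rV[R]_m) :
  is_derive x v f df -> is_derive x v g dg ->
  is_derive x v (fun y => dot (f y) (g y)) (dot df (g x) + dot (f x) dg).
Proof.
move=> dfx dgx.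
have cf i := is_derive_coord 0 i dfx.
have cg i := is_derive_coord 0 i dgx.
have -> : (fun y => dot (f y) (g y)) =
    \sum_(i < m) ((fun y => f y 0 i) * (fun y => g y 0 i)).
  by apply/funext => y; rewrite dotE fct_sumE.
apply: (is_derive_eq (is_derive_sum _)).
rewrite !dotE -big_split; apply: eq_bigr => i _ /=.
by rewrite /GRing.scale/= addrC mulrC [X in _ + X = _]mulrC; congr (_ + _); rewrite mulrC.
Qed.

(** Everything is restricted to the line through [x] directed by [v]. If [f2] were negative, [f1]
    would be negative just after [x], and the mean value theorem would give a value of [f] below
    [f x]. *)
Lemma second_derivative_test (R : realType) (V : normedModType R)
    (f f1 : V -> R) (x v : V) (f2 : R) :
  (\forall y \near x, f x <= f y) ->
  (\forall y \near x, is_derive y v f (f1 y)) ->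
  is_derive x v f1 f2 -> f1 x = 0 /\ 0 <= f2.
Proof.
move=> fmin df df1.
pose l (t : R) : V := t *: v + x.
have l0 : l 0 = x by rewrite /l scale0r add0r.
have cl : {for 0, continuous l}.
  apply: cvgD; last exact: cvg_cst.
  by apply: cvgZr_tmp; exact: cvg_id.
have line (h : V -> R) t dh : is_derive (l t) v h dh ->
    is_derive t 1 (h \o l) dh.
  have E : (fun k => k^-1 *: (((h \o l) \o shift t) (k *: 1) - (h \o l) t)) =
           (fun k => k^-1 *: ((h \o shift (l t)) (k *: v) - h (l t))).
    by apply/funext => k /=; rewrite /l [_%:A]mulr1 scalerDl addrA.
  by move=> [hd <-]; apply: DeriveDef; rewrite /derivable /derive E.
have [e /= e0 He] : \forall t \near 0, f x <= f (l t) /\ is_derive (l t) v f (f1 (l t)).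
  have : \forall y \near l 0, f x <= f y /\ is_derive y v f (f1 y).
    by rewrite l0; near=> y; split; near: y.
  exact: cl.
have {}He t : `|t| < e -> f x <= f (l t) /\ is_derive t 1 (f \o l) (f1 (l t)).
  move=> te; have [|fl dfl] := He t; first by rewrite /= sub0r normrN.
  by split=> //; exact: line.
have He' t : t \in `](- e), e[ -> `|t| < e by rewrite in_itv /= ltr_norml.
have f10 : f1 x = 0.
  have d0 : is_derive (0 : R) 1 (f \o l) 0.
    apply: (@derive1_at_min _ _ (- e) e) => [|t /He' te||t /He' te].
    - by rewrite ge0_cp// ltW.
    - by have [_ []] := He t te.
    - by rewrite in_itv /= oppr_lt0 e0.
    - by rewrite /= l0; have [] := He t te.
  have [|_ d1] := He 0; first by rewrite normr0.
  by rewrite -l0 -(@derive_val _ _ _ _ _ _ _ d1) (@derive_val _ _ _ _ _ _ _ d0).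
split=> //; rewrite leNgt; apply/negP => f20.
have [dfl Efl] : is_derive (0 : R) 1 (f1 \o l) f2 by apply: line => //; rewrite l0.
have := dfl; rewrite /derivable => /cvg_ex[f2' cf2].
have f2E : f2' = f2 by rewrite -Efl; apply/esym/cvg_lim.
have [d /= d0 Hd] : \forall t \near 0^', t^-1 *: (f1 (l t) - f1 x) < 0.
  apply: (@cvgr_lt _ _ _ _ _ f2) => //.
  rewrite -f2E; apply: cvg_trans cf2; apply: near_eq_cvg.
  by apply: nearW => t /=; rewrite addr0 [_%:A]mulr1 l0.
have f1neg t : 0 < t -> t < d -> f1 (l t) < 0.
  move=> t0 td; have := Hd t; rewrite /= sub0r normrN gtr0_norm// td.
  move=> /(_ isT) /(_ (lt0r_neq0 t0)).
  by rewrite f10 subr0 /GRing.scale/= pmulr_rlt0// invr_gt0.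
(* Halving keeps the whole segment from 0 to [s] where [f1] has its sign and where [f] is
   differentiable and at least [f x]. *)
pose s := Num.min d e / 2.
have de0 : 0 < Num.min d e by rewrite lt_min d0.
have s0 : 0 < s by rewrite divr_gt0.
have : s < Num.min d e by rewrite ltr_pdivrMr// mulrDr mulr1 ltrDl.
rewrite lt_min => /andP[sd se].
have der t : 0 <= t -> t <= s -> is_derive t 1 (f \o l) (f1 (l t)).
  move=> t0 ts; have [|//] := He t; by rewrite ger0_norm// (le_lt_trans ts).
have [|||c] := @MVT _ (f \o l) (f1 \o l) 0 s.
- exact: s0.
- by move=> t; rewrite in_itv /= => /andP[t0 ts]; apply: der; exact: ltW.
- apply: derivable_within_continuous => t; rewrite in_itv /= => /andP[t0 ts].
  by have [] := der t t0 ts.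
rewrite in_itv /= => /andP[c0 cs] E.
have [|fs _] := He s; first by rewrite gtr0_norm.
move: fs; rewrite -subr_ge0 -[f x]/(f x) -{1}l0 E subr0 pmulr_lge0// leNgt.
by rewrite f1neg// (lt_trans cs).
Unshelve. all: by end_near. Qed.

(** * The weighted mean curvature vector in coordinates *)

Section parametrized.
Context {R : realType} {n m : nat}.
Implicit Types (U : set 'rV[R]_n) (Y : 'rV[R]_n -> 'rV[R]_m) (x u v : 'rV[R]_n).

Lemma derive_sum_delta Y x v : differentiable Y x ->
  'D_v Y x = \sum_i v 0 i *: 'D_(delta_mx 0 i) Y x.
Proof.
move=> dY; rewrite deriveEjacobian// [in LHS](row_sum_delta v) mulmx_suml.
by apply: eq_bigr => i _; rewrite deriveEjacobian// scalemxAl.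
Qed.

Lemma derive2_sum_delta U Y x u v : open U -> Ck_on 2 U Y -> U x ->
  'D_u ('D_v Y) x =
  \sum_i \sum_j (u 0 i * v 0 j) *:
     'D_(delta_mx 0 i) ('D_(delta_mx 0 j) Y) x.
Proof.
move=> oU [dY d2Y] Ux.
have d2 w : differentiable ('D_w Y) x by have [+ _] := d2Y w; exact.
(* The expansion of the inner derivative must hold on a neighbourhood of [x] before it can be
   differentiated again. *)
have E : \forall y \near x,
    \sum_i (v 0 i *: 'D_(delta_mx 0 i) Y) y = 'D_v Y y.
  have : \forall y \near x, U y by exact: open_nbhs_nbhs.
  by apply: filterS => y Uy; rewrite (derive_sum_delta _ (dY _ Uy)).
rewrite -(near_eq_derive u E).
have -> : (fun y => \sum_i (v 0 i *: 'D_(delta_mx 0 i) Y) y) =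
    \sum_i (v 0 i *: 'D_(delta_mx 0 i) Y).
  by apply/funext => y; rewrite fct_sumE.
rewrite derive_sum => [|i]; last by apply: derivableZ; exact: diff_derivable.
rewrite exchange_big/=; apply: eq_bigr => j _.
rewrite deriveZ; last exact: diff_derivable.
rewrite (derive_sum_delta u (d2 _)) scaler_sumr; apply: eq_bigr => i _.
by rewrite scalerA mulrC.
Qed.

(* The columns of [frame] are directions v_k with sum_k v_k^T v_k the inverse
   metric, so that second order traces become sums of second directional
   derivatives. *)
Definition frame Y x : 'M[R]_(n, m) :=
  invmx (first_fundamental_form Y x) *m 'J Y x.
Definition frame_dir Y x (k : 'I_m) : 'rV[R]_n := row k (frame Y x)^T.
Definition trace_hessian Y x : 'rV[R]_m :=
  \sum_i \sum_j invmx (first_fundamental_form Y x) i j *: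
    'D_(delta_mx 0 i) ('D_(delta_mx 0 j) Y) x.
(** Coordinates of the tangential part of [trace_hessian Y x + Y x]: multiplied on the right by the
    Jacobian, this vector gives that tangential part. *)
Definition drift Y x : 'rV[R]_n :=
  (trace_hessian Y x + Y x) *m ('J Y x)^T *m
    invmx (first_fundamental_form Y x).

(** A Gram matrix: if [u] is in its kernel, then [u *m 'J Y x] has length zero, so [u] vanishes by
    row freeness. *)
Lemma first_fundamental_form_unit Y x :
  row_free ('J Y x) -> first_fundamental_form Y x \in unitmx.
Proof.
move=> rf; rewrite -row_free_unit -kermx_eq0; apply/eqP/row_matrixP => i.
rewrite row0; set u := row i _.
have /sub_kermxP : (u <= kermx (first_fundamental_form Y x))%MS.
  exact: row_sub.
rewrite /first_fundamental_form mulmxA => u0.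
apply: (row_free_inj rf); rewrite mul0mx; apply/eqP.
by rewrite -dotuu_eq0 /dot trmx_mul mulmxA u0 mul0mx mxE.
Qed.

Lemma first_fundamental_form_tr Y x :
  (first_fundamental_form Y x)^T = first_fundamental_form Y x.
Proof. by rewrite /first_fundamental_form trmx_mul trmxK. Qed.

Lemma frame_mul_tr Y x : row_free ('J Y x) ->
  frame Y x *m (frame Y x)^T = invmx (first_fundamental_form Y x).
Proof.
move=> /first_fundamental_form_unit gu.
rewrite /frame trmx_mul trmx_inv first_fundamental_form_tr.
rewrite mulmxA -(mulmxA (invmx _)) -/(first_fundamental_form Y x).
by rewrite mulVmx// mul1mx.
Qed.

Lemma sum_derive2_frame U Y x : open U -> Ck_on 2 U Y -> U x ->
  row_free ('J Y x) ->
  \sum_k 'D_(frame_dir Y x k) ('D_(frame_dir Y x k) Y) x = trace_hessian Y x.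
Proof.
move=> oU cY Ux rf; rewrite /trace_hessian -frame_mul_tr//.
under eq_bigr do rewrite (derive2_sum_delta _ _ oU cY Ux).
rewrite exchange_big; apply: eq_bigr => i _ /=.
rewrite exchange_big; apply: eq_bigr => j _ /=.
by rewrite -scaler_suml mxE; congr (_ *: _); apply: eq_bigr => k _; rewrite !mxE.
Qed.

(** The derivatives of [Y] along the frame are the rows of the orthogonal projection onto the
    tangent space. Their squared lengths add up to the trace of this projection, its rank. *)
Lemma sum_sqr_derive_frame Y x : differentiable Y x -> row_free ('J Y x) ->
  \sum_k dot ('D_(frame_dir Y x k) Y x) ('D_(frame_dir Y x k) Y x) = n%:R.
Proof.
move=> dY rf; have gu := first_fundamental_form_unit rf.
have <- : \tr (frame Y x *m ('J Y x)^T) = n%:R.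
  by rewrite /frame -mulmxA mulVmx// mxtrace1.
rewrite mxtrace_mulC.
have -> : ('J Y x)^T *m frame Y x = (frame Y x)^T *m 'J Y x *m ((frame Y x)^T *m 'J Y x)^T.
  rewrite /frame !trmx_mul !trmxK trmx_inv first_fundamental_form_tr -!mulmxA.
  congr (_ *m _); rewrite [in RHS](mulmxA ('J Y x)) -/(first_fundamental_form Y x).
  by rewrite [X in _ = _ *m X]mulmxA mulmxV// mul1mx.
by apply: eq_bigr => k _; rewrite deriveEjacobian// /frame_dir -row_mul /dot !mxE;
  apply: eq_bigr => i _; rewrite !mxE.
Qed.

(** By linearity of the projection, the weighted mean curvature vector is the normal part of
    [trace_hessian Y x + Y x]; the tangential part to be subtracted is the derivative of [Y] along
    the drift. *)
Lemma weighted_mean_curvature_drift Y x : differentiable Y x ->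
  weighted_mean_curvature_vector Y x =
  trace_hessian Y x + Y x - 'D_(drift Y x) Y x.
Proof.
move=> dY; rewrite deriveEjacobian// /drift.
rewrite /weighted_mean_curvature_vector /mean_curvature_vector.
rewrite /second_fundamental_form /normal_part /tangent_part.
set g := invmx _; set J := 'J Y x.
rewrite !mulmxDl opprD addrACA; congr (_ + _); rewrite /trace_hessian.
rewrite !mulmx_suml -sumrB; apply: eq_bigr => i _.
rewrite !mulmx_suml -sumrB; apply: eq_bigr => j _.
by rewrite scalerBr -!scalemxAl.
Qed.

(* Local maximum principle: the left-hand side of the conclusion is the drift
   Laplacian of psi, the right-hand side that of the linear function. *)
Lemma interior_min U Y x (nu : 'rV[R]_m) (psi : 'rV[R]_n -> R)
    (psi1 : 'rV[R]_n -> 'rV[R]_n -> R) (psi2 : 'rV[R]_n -> R) :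
  open U -> Ck_on 2 U Y -> U x -> row_free ('J Y x) ->
  (forall v y, U y -> is_derive y v psi (psi1 v y)) ->
  (forall v, is_derive x v (psi1 v) (psi2 v)) ->
  (\forall y \near x, dot (Y x) nu - psi x <= dot (Y y) nu - psi y) ->
  \sum_k psi2 (frame_dir Y x k) - psi1 (drift Y x) x <=
  dot (weighted_mean_curvature_vector Y x - Y x) nu.
Proof.
move=> oU cY Ux rf d1 d2 xmin; have [dY d2Y] := cY.
have d1lin v y : U y -> is_derive y v (fun y => dot (Y y) nu - psi y)
    (dot ('D_v Y y) nu - psi1 v y).
  move=> Uy; have dpsi := d1 v y Uy; apply: is_deriveB.
  apply: (is_derive_eq (@is_derive_dot _ _ _ Y (cst nu) _ _ _ 0 _ _)).
    by apply: derivableP; exact/diff_derivable/dY.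
  by rewrite dot0r addr0.
have d2lin v : is_derive x v (fun y => dot ('D_v Y y) nu - psi1 v y)
    (dot ('D_v ('D_v Y) x) nu - psi2 v).
  apply: is_deriveB.
  apply: (is_derive_eq (@is_derive_dot _ _ _ ('D_v Y) (cst nu) _ _ _ 0 _ _)).
    by apply: derivableP; apply: diff_derivable; have [+ _] := d2Y v; exact.
  by rewrite dot0r addr0.
(* The first order condition, used along the drift, matches the first order terms; the second order
   one is summed over the frame. *)
have test v : dot ('D_v Y x) nu - psi1 v x = 0 /\
    0 <= dot ('D_v ('D_v Y) x) nu - psi2 v.
  apply: second_derivative_test xmin _ (d2lin v).
  have : \forall y \near x, U y by exact: open_nbhs_nbhs.
  by apply: filterS => y; exact: d1lin.
rewrite weighted_mean_curvature_drift; last exact: dY.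
rewrite addrAC addrK dotDl dotNl.
have [/subr0_eq -> _] := test (drift Y x).
rewrite lerD2r -(sum_derive2_frame oU)// dot_suml.
by apply: ler_sum => k _; rewrite -subr_ge0; have [] := test (frame_dir Y x k).
Qed.

End parametrized.

(** * Continuity of the frame and of the drift *)

Section parametrized_continuity.
Context {R : realType} {n m : nat}.
Variables (U : set 'rV[R]_n) (Y : 'rV[R]_n -> 'rV[R]_m) (x : 'rV[R]_n).
Hypotheses (oU : open U) (cY : Ck_on 2 U Y) (Ux : U x) (rf : row_free ('J Y x)).
(* Convergence along an abstract filter finer than [nbhs x], as unification
   unfolds [nbhs x] for matrices. *)
Variables (F : set_system 'rV[R]_n) (FF : Filter F) (Fx : F --> x).

Let cvgF (m' : nat) (f : 'rV[R]_n -> 'rV[R]_m') :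
  {for x, continuous f} -> f @ F --> f x.
Proof. by move=> cf; exact: cvg_comp Fx cf. Qed.

Let derive_cvg v : 'D_v Y @ F --> 'D_v Y x.
Proof.
apply: cvgF; apply: differentiable_continuous.
by have [_ +] := cY => /(_ v)[+ _]; exact.
Qed.

Let derive2_cvg u v : 'D_u ('D_v Y) @ F --> 'D_u ('D_v Y) x.
Proof. by apply: cvgF; have [_ +] := cY => /(_ v)[_ +]; exact. Qed.

Lemma Ck_on_cvg : Y @ F --> Y x.
Proof. by apply: cvgF; apply: differentiable_continuous; have [+ _] := cY; exact. Qed.

Lemma jacobian_cvg : 'J Y y @[y --> F] --> 'J Y x.
Proof.
have [dY d2Y] := cY.
have JE y : U y -> 'J Y y = \matrix_(i, j) ('D_(delta_mx 0 i) Y y) 0 j.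
  move=> Uy; apply/row_matrixP => i; rewrite rowE -deriveEjacobian; last exact: dY.
  by apply/rowP => j; rewrite !mxE.
rewrite JE//.
have nE : \forall y \near F, \matrix_(i, j) ('D_(delta_mx 0 i) Y y) 0 j = 'J Y y.
  have : \forall y \near F, U y by apply: Fx; exact: open_nbhs_nbhs.
  by apply: filterS => y Uy; rewrite JE.
apply: (cvg_trans (near_eq_cvg nE)).
apply/cvg_mxP => i j; rewrite mxE; under eq_cvg do rewrite mxE.
exact: (cvg_coord 0 j (@derive_cvg (delta_mx 0 i))).
Qed.

Lemma first_fundamental_form_cvg :
  invmx (first_fundamental_form Y y) @[y --> F] -->
  invmx (first_fundamental_form Y x).
Proof.
apply: cvg_invmx; first exact: first_fundamental_form_unit.
by apply: cvg_mulmx; [|apply: cvg_trmx]; exact: jacobian_cvg.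
Qed.

Lemma frame_cvg : frame Y y @[y --> F] --> frame Y x.
Proof.
rewrite /frame; exact (cvg_mulmx first_fundamental_form_cvg jacobian_cvg).
Qed.

Lemma frame_dir_cvg k : frame_dir Y y k @[y --> F] --> frame_dir Y x k.
Proof. rewrite /frame_dir; exact (cvg_row (cvg_trmx frame_cvg)). Qed.

Lemma drift_cvg : drift Y y @[y --> F] --> drift Y x.
Proof.
apply: cvg_mulmx; last exact: first_fundamental_form_cvg.
apply: cvg_mulmx; last by apply: cvg_trmx; exact: jacobian_cvg.
apply: cvgD; last exact: Ck_on_cvg.
apply: cvg_sum => i; apply: cvg_sum => j; apply: cvgZ; last exact: derive2_cvg.
exact: (cvg_coord i j first_fundamental_form_cvg).
Qed.

End parametrized_continuity.

(** * The barrier at a contact point *)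

Section touching_barrier.
Context {R : realType} {n : nat}.
Implicit Types (c z y v : 'rV[R]_n).

(* Hopf-type barrier: it vanishes at z, is negative at the other points near z
   outside the ball centred at c through z, and its drift Laplacian is
   positive at z when a is large. *)
Definition ball_defect c z y := dot (z - c) (z - c) - dot (y - c) (y - c).
Definition barrier a c z y :=
  ball_defect c z y + a * ball_defect c z y ^+ 2 - dot (y - z) (y - z).
Definition barrier1 a c z v y :=
  - (1 + 2 * a * ball_defect c z y) * (2 * dot (y - c) v) - 2 * dot (y - z) v.
(** At [y = z] the defect vanishes, so [a] survives only as the coefficient of a square. *)
Definition barrier2 a c z v y :=
  8 * a * dot (y - c) v ^+ 2 - (1 + 2 * a * ball_defect c z y) * (2 * dot v v)
  - 2 * dot v v.

Lemma is_derive_dot_sub c v y :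
  is_derive y v (fun y => dot (y - c) v) (dot v v).
Proof.
have d : is_derive y v (fun y => y - c) v.
  by apply: (is_derive_eq (is_deriveB _ _)); rewrite subr0.
apply: (is_derive_eq (@is_derive_dot _ _ _ _ (cst v) _ _ _ 0 d _)).
by rewrite dot0r addr0.
Qed.

Lemma is_derive_sqr_dist c v y :
  is_derive y v (fun y => dot (y - c) (y - c)) (2 * dot (y - c) v).
Proof.
have d : is_derive y v (fun y => y - c) v.
  by apply: (is_derive_eq (is_deriveB _ _)); rewrite subr0.
by apply: (is_derive_eq (is_derive_dot d d)); rewrite (dotC v) mulr2n mulrDl mul1r.
Qed.

Lemma is_derive_ball_defect c z v y :
  is_derive y v (ball_defect c z) (- (2 * dot (y - c) v)).
Proof.
have d := is_derive_sqr_dist c v y.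
by apply: (is_derive_eq (is_deriveB _ _)); rewrite sub0r.
Qed.

Lemma is_derive_barrier a c z v y :
  is_derive y v (barrier a c z) (barrier1 a c z v y).
Proof.
have d := is_derive_ball_defect c z v y.
have -> : barrier a c z = ball_defect c z + a *: (ball_defect c z * ball_defect c z)
    - (fun y => dot (y - z) (y - z)).
  by apply/funext => t; rewrite /barrier expr2.
apply: (is_derive_eq (is_deriveB (is_deriveD d (is_deriveZ a (is_deriveM d d)))
  (is_derive_sqr_dist z v y))).
by rewrite /barrier1 /GRing.scale/=; ring.
Qed.

Lemma is_derive_barrier1 a c z v y :
  is_derive y v (barrier1 a c z v) (barrier2 a c z v y).
Proof.
have -> : barrier1 a c z v =
    (- cst 1 + (- 2 * a) *: ball_defect c z) * (2 *: (fun y => dot (y - c) v))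
    - 2 *: (fun y => dot (y - z) v).
  by apply/funext => t; rewrite /barrier1 opprD -!mulNr.
apply: (is_derive_eq (is_deriveB (is_deriveM
   (is_deriveD (is_deriveN (is_derive_cst (1 : R) y v))
     (is_deriveZ (- 2 * a) (is_derive_ball_defect c z v y)))
   (is_deriveZ 2 (is_derive_dot_sub c v y)))
   (is_deriveZ 2 (is_derive_dot_sub z v y)))).
rewrite /barrier2 /GRing.scale/=.
have -> : (- cst 1 + (- 2 * a) *: ball_defect c z) y =
  - 1 + - 2 * a * ball_defect c z y by [].
by rewrite /GRing.scale/=; ring.
Qed.

Section cvg.
Context {T : Type} (F : set_system T) {FF : Filter F}.
Variables (y : T -> 'rV[R]_n) (v : T -> 'rV[R]_n) (yl vl : 'rV[R]_n).
Hypothesis (cy : y @ F --> yl).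

Let cvgs c : y t - c @[t --> F] --> yl - c.
Proof. by apply: cvgB => //; exact: cvg_cst. Qed.

Lemma cvg_ball_defect c z : ball_defect c z (y t) @[t --> F] --> ball_defect c z yl.
Proof. by apply: cvgB; [exact: cvg_cst|exact: cvg_dot]. Qed.

Lemma cvg_barrier a c z : barrier a c z (y t) @[t --> F] --> barrier a c z yl.
Proof.
have cd := @cvg_ball_defect c z.
apply: cvgB; last exact: cvg_dot.
by apply: cvgD => //; apply: cvgM; [exact: cvg_cst|exact: cvgM].
Qed.

Hypothesis (cv : v @ F --> vl).

Let cvgsv c : dot (y t - c) (v t) @[t --> F] --> dot (yl - c) vl.
Proof. exact: cvg_dot. Qed.

Let cvgq a c z : 1 + 2 * a * ball_defect c z (y t) @[t --> F] -->
  1 + 2 * a * ball_defect c z yl.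
Proof.
apply: cvgD; first exact: cvg_cst.
by apply: cvgM; [exact: cvg_cst|exact: cvg_ball_defect].
Qed.

Lemma cvg_barrier1 a c z :
  barrier1 a c z (v t) (y t) @[t --> F] --> barrier1 a c z vl yl.
Proof.
apply: cvgB.
  apply: cvgM; first by apply: cvgN; exact: cvgq.
  by apply: cvgM; [exact: cvg_cst|exact: cvgsv].
by apply: cvgM; [exact: cvg_cst|exact: cvgsv].
Qed.

Lemma cvg_barrier2 a c z :
  barrier2 a c z (v t) (y t) @[t --> F] --> barrier2 a c z vl yl.
Proof.
have cvv : 2 * dot (v t) (v t) @[t --> F] --> 2 * dot vl vl.
  by apply: cvgM; [exact: cvg_cst|exact: cvg_dot].
apply: cvgB => //; apply: cvgB; last by apply: cvgM => //; exact: cvgq.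
apply: cvgM; first exact: cvg_cst.
by apply: cvgM; exact: cvgsv.
Qed.

End cvg.

Lemma ball_defect_continuous c z : continuous (ball_defect c z).
Proof. move=> y; exact: (cvg_ball_defect (F := nbhs y) (y := id) (@cvg_id _ _)). Qed.

Lemma barrier_continuous a c z : continuous (barrier a c z).
Proof. move=> y; exact: (cvg_barrier (F := nbhs y) (y := id) (@cvg_id _ _)). Qed.

End touching_barrier.

(** * The strong maximum principle *)

(** Ellipticity: the sum is the inverse metric evaluated on [v], written as the squared length of
    [v *m frame Y x]. *)
Lemma dot_frame_gt0 (R : realType) (n m : nat) (Y : 'rV[R]_n -> 'rV[R]_m)
    (x v : 'rV[R]_n) :
  row_free ('J Y x) -> v != 0 -> 0 < \sum_k dot v (frame_dir Y x k) ^+ 2.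
Proof.
move=> rf v0.
have -> : \sum_k dot v (frame_dir Y x k) ^+ 2 =
    dot (v *m frame Y x) (v *m frame Y x).
  rewrite dotE; apply: eq_bigr => k _; rewrite expr2.
  suff -> : dot v (frame_dir Y x k) = (v *m frame Y x) 0 k by [].
  by rewrite dotE mxE; apply: eq_bigr => i _; rewrite !mxE.
rewrite dotuu_gt0; apply: contra_neq v0 => vN.
have gu := first_fundamental_form_unit rf.
have : v *m invmx (first_fundamental_form Y x) = 0.
  by apply: (row_free_inj rf); rewrite mul0mx -mulmxA.
by move/(congr1 (mulmxr (first_fundamental_form Y x))); rewrite /= mulmxKV// mul0mx.
Qed.

Lemma continuous_norm_sub (R : realType) (n : nat) (z : 'rV[R]_n) :
  continuous (fun y : 'rV[R]_n => `|z - y|).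
Proof. move=> y; exact (cvg_norm (cvgB (cvg_cst z) (@cvg_id _ (nbhs y)))). Qed.

Lemma closed_closed_norm_ball (R : realType) (n : nat) (z : 'rV[R]_n) (r : R) :
  closed [set y | `|z - y| <= r].
Proof.
exact: (closed_comp (fun y _ => @continuous_norm_sub _ _ z y) (@closed_le _ r)).
Qed.

Lemma compact_closed_norm_ball (R : realType) (n : nat) (z : 'rV[R]_n) (r : R) :
  compact [set y | `|z - y| <= r].
Proof.
apply: bounded_closed_compact; last exact: closed_closed_norm_ball.
exists (`|z| + r); split; first exact: num_real.
move=> M /ltW hM y yC; apply: le_trans hM => /=.
have -> : y = z - (z - y) by rewrite subKr.
by rewrite (le_trans (ler_normB _ _))// lerD2l.
Qed.

Section strong_maximum_principle.
Context {R : realType} {n m : nat}.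
Variables (U : set 'rV[R]_n) (Y : 'rV[R]_n -> 'rV[R]_m).
Variables (nu : 'rV[R]_m) (lambda : R).
Hypotheses (oU : open U) (cY : Ck_on 2 U Y).
Hypothesis rf : forall x, U x -> row_free ('J Y x).
Hypothesis Y_ge : forall x, U x -> lambda <= dot (Y x) nu.
(** By [weighted_mean_curvature_drift], the left-hand side is the drift Laplacian of the height in
    direction [nu], which is thus a supersolution. *)
Hypothesis Y_super : forall x, U x ->
  dot (weighted_mean_curvature_vector Y x - Y x) nu <= 0.

Definition drift_laplacian_barrier a c z y : R :=
  \sum_k barrier2 a c z (frame_dir Y y k) y - barrier1 a c z (drift Y y) y.

(** At [z] the drift Laplacian is affine in [a], with positive slope by ellipticity since [c]
    differs from [z]. Continuity of the frame and the drift carries positivity to nearby points. *)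
Lemma drift_laplacian_barrier_gt0 c z : U z -> c != z ->
  exists a, \forall y \near z, 0 < drift_laplacian_barrier a c z y.
Proof.
move=> Uz cz.
have s0 : 0 < \sum_k dot (z - c) (frame_dir Y z k) ^+ 2.
  by apply: dot_frame_gt0; [exact: rf|rewrite subr_eq0 eq_sym].
set s := \sum_k _ in s0.
pose tr := \sum_k 4 * dot (frame_dir Y z k) (frame_dir Y z k) -
  2 * dot (z - c) (drift Y z).
(* With [tr] collecting the terms free of [a], the value at [z] is [8 * a * s - tr]; this choice
   makes it 1. *)
exists ((tr + 1) / (8 * s)).
set a := _ / _.
have L0 : 0 < drift_laplacian_barrier a c z z.
  have -> : drift_laplacian_barrier a c z z = 8 * a * s - tr.
    have E1 : barrier1 a c z (drift Y z) z = - 2 * dot (z - c) (drift Y z).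
      by rewrite /barrier1 /ball_defect !subrr dot0l; ring.
    have E2 : \sum_k barrier2 a c z (frame_dir Y z k) z =
        8 * a * s - \sum_k 4 * dot (frame_dir Y z k) (frame_dir Y z k).
      rewrite /s mulr_sumr -sumrB; apply: eq_bigr => k _.
      by rewrite /barrier2 /ball_defect subrr; ring.
    by rewrite /drift_laplacian_barrier E1 E2 /tr; ring.
  have -> : 8 * a * s = tr + 1 by rewrite /a; field; rewrite gt_eqF.
  by rewrite addrAC subrr add0r.
have cL : drift_laplacian_barrier a c z y @[y --> z] --> drift_laplacian_barrier a c z z.
  have gen (F : set_system 'rV[R]_n) (FF : Filter F) : F --> z ->
      drift_laplacian_barrier a c z y @[y --> F] --> drift_laplacian_barrier a c z z.
    move=> Fz; apply: cvgB.
      apply: cvg_sum => k; apply: cvg_barrier2 => //.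
      by apply: (frame_dir_cvg oU cY) => //; exact: rf.
    by apply: cvg_barrier1 => //; apply: (drift_cvg oU cY) => //; exact: rf.
  exact: (gen _ (nbhs_filter z)).
exact: cvgr_gt cL _ L0.
Qed.

(** Otherwise a small multiple of the barrier can be subtracted from the height so that the minimum
    over a small ball about [z] is interior. There the drift Laplacian of the barrier is positive
    and that of the height nonpositive, against [interior_min]. *)
Lemma no_touching c z : U z -> c != z -> dot (Y z) nu = lambda ->
  (\forall y \near z, dot (Y y) nu = lambda ->
     dot (z - c) (z - c) <= dot (y - c) (y - c)) -> False.
Proof.
move=> Uz cz Yz ztouch.
have [a La] := drift_laplacian_barrier_gt0 Uz cz.
have nU : \forall y \near z, U y by exact: open_nbhs_nbhs.
(* The first two terms of the barrier are the defect times this factor, so near [z] they have the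
   sign of the defect. *)
have na : \forall y \near z, 0 < 1 + a * ball_defect c z y.
  have c1 : 1 + a * ball_defect c z y @[y --> z] --> 1 + a * ball_defect c z z.
    exact (cvgD (cvg_cst (1 : R)) (cvgM (cvg_cst (a : R)) (@ball_defect_continuous _ _ c z z))).
  by apply: cvgr_gt c1 _ _; rewrite /ball_defect subrr mulr0 addr0 ltr01.
have : \forall y \near z, [/\ U y, 0 < drift_laplacian_barrier a c z y,
    0 < 1 + a * ball_defect c z y & dot (Y y) nu = lambda ->
    dot (z - c) (z - c) <= dot (y - c) (y - c)].
  by near=> y; split; near: y.
move=> /nbhs_ballP[r' /= r'0 Hr'].
pose r := r' / 2.
have r0 : 0 < r by rewrite divr_gt0.
have {Hr'} Hr y : `|z - y| <= r -> [/\ U y, 0 < drift_laplacian_barrier a c z y,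
    0 < 1 + a * ball_defect c z y & dot (Y y) nu = lambda ->
    dot (z - c) (z - c) <= dot (y - c) (y - c)].
  move=> yr; apply: Hr'; rewrite -ball_normE /=; apply: (le_lt_trans yr).
  by rewrite /r ltr_pdivrMr// mulrDr mulr1 ltrDl.
pose C : set 'rV[R]_n := [set y | `|z - y| <= r].
have cdist := @continuous_norm_sub R n z.
have clC : closed C by exact: closed_closed_norm_ball.
have cC : compact C by exact: compact_closed_norm_ball.
have cYnu y : C y -> {for y, continuous (fun y => dot (Y y) nu)}.
  move=> /Hr[Uy _ _ _].
  have : Y @ y --> Y y.
    by apply: differentiable_continuous; have [+ _] := cY; exact.
  move=> cYy; exact (cvg_dot cYy (cvg_cst nu)).
have ch : continuous (barrier a c z) by exact: barrier_continuous.
have hz : barrier a c z z = 0.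
  by rewrite /barrier /ball_defect !subrr dot0l expr0n /= mulr0 addr0 subr0.
have [eps eps0 Heps] : exists2 eps, 0 < eps & forall y, `|z - y| = r ->
    eps * barrier a c z y < dot (Y y) nu - lambda.
  (* Only where the barrier is nonnegative does [eps] have to be small. No such point of the sphere
     is a contact point: there the defect would be nonpositive and the last term of the barrier
     strictly negative. *)
  pose K : set 'rV[R]_n := C `&` [set y | `|z - y| = r /\ 0 <= barrier a c z y].
  have Kpos y : K y -> 0 < dot (Y y) nu - lambda.
    move=> [yC [yr hy]]; have [Uy _ ay touch] := Hr _ yC.
    rewrite lt_neqAle subr_ge0 Y_ge// andbT eq_sym subr_eq0; apply/eqP => Yy.
    move: hy; apply/negP; rewrite -ltNge.
    have : ball_defect c z y <= 0 by rewrite subr_le0 touch.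
    rewrite -(pmulr_lle0 _ ay) => ba.
    have ry : 0 < dot (y - z) (y - z).
      rewrite dotuu_gt0 subr_eq0; apply/eqP => yz.
      by move: r0; rewrite -yr yz subrr normr0 ltxx.
    by rewrite /barrier; move: ba ry; nra.
  have [K0|/set0P K0] := eqVneq K set0.
    exists 1 => // y yr.
    have yC : C y by rewrite /C /= yr.
    have [Uy _ _ _] := Hr _ yC.
    rewrite mul1r; apply: lt_le_trans (_ : 0 <= _); last by rewrite subr_ge0 Y_ge.
    rewrite ltNge; apply/negP => hy.
    by have : K y by []; rewrite K0.
  have cK : compact K.
    apply: compact_closedI => //.
    apply: closedI; last exact: (closed_comp (fun y _ => ch y) (@closed_ge _ 0)).
    exact: (closed_comp (fun y _ => cdist y) (@closed_eq _ r)).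
  have [|y1 /[1!inE] Ky1 y1min] := @compact_EVT_min _ _ (fun y => dot (Y y) nu - lambda) K K0 cK.
    apply: continuous_in_subspaceT => y /[1!inE] -[yC _].
    exact (cvgB (cYnu y yC) (cvg_cst (lambda : R))).
  have [|y2 /[1!inE] Ky2 y2max] := @compact_EVT_max _ _ (barrier a c z) K K0 cK.
    by apply: continuous_in_subspaceT => y _; exact: ch.
  have c0 := Kpos _ Ky1.
  have h0 : 0 <= barrier a c z y2 by case: Ky2 => _ [].
  (* Smallest height gap on [K] over largest barrier value; adding 1 keeps the denominator positive
     and the inequality strict. *)
  exists ((dot (Y y1) nu - lambda) / (barrier a c z y2 + 1)).
    by rewrite divr_gt0// ltr_wpDl.
  move=> y yr.
  have yC : C y by rewrite /C /= yr.
  have [Uy _ _ _] := Hr _ yC.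
  have [hy|hy] := leP 0 (barrier a c z y).
    have Ky : K y by [].
    apply: lt_le_trans (y1min y (mem_set Ky)).
    rewrite mulrAC ltr_pdivrMr ?ltr_wpDl// ltr_pM2l// ltr_pwDr//.
    by apply: y2max; exact: mem_set.
  apply: lt_le_trans (_ : 0 <= _); last by rewrite subr_ge0 Y_ge.
  by rewrite nmulr_llt0// divr_gt0// ltr_wpDl.
pose psi y := eps * barrier a c z y.
have Cz : C z by rewrite /C /= subrr normr0 ltW.
have [||x1 /[1!inE] Cx1 x1min] := @compact_EVT_min _ _ (fun y => dot (Y y) nu - psi y) C _ cC.
- by exists z.
- apply: continuous_in_subspaceT => y /[1!inE] yC.
  exact (cvgB (cYnu y yC) (cvgM (cvg_cst (eps : R)) (ch y))).
(* On the sphere the perturbed height exceeds [lambda], its value at the centre [z]. *)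
have x1r : `|z - x1| < r.
  rewrite lt_neqAle Cx1 andbT; apply/eqP => x1r.
  have := Heps _ x1r; apply/negP; rewrite -leNgt.
  have := x1min z (mem_set Cz); rewrite /psi hz mulr0 subr0 Yz.
  by rewrite lerBlDr addrC -lerBlDr.
have [Ux1 Lx1 _ _] := Hr _ Cx1.
have := @interior_min _ _ _ U Y x1 nu psi (fun v y => eps * barrier1 a c z v y)
  (fun v => eps * barrier2 a c z v x1) oU cY Ux1 (rf Ux1).
move=> /(_ (fun v y _ => is_deriveZ eps (is_derive_barrier a c z v y))).
move=> /(_ (fun v => is_deriveZ eps (is_derive_barrier1 a c z v x1))).
have nC : \forall y \near x1, C y.
  have : \forall y \near x1, `|z - y| < r by exact: cvgr_lt (cdist x1) _ x1r.
  by apply: filterS => y /ltW.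
have nmin : \forall y \near x1, dot (Y x1) nu - psi x1 <= dot (Y y) nu - psi y.
  by apply: filterS nC => y Cy; apply: x1min; exact: mem_set.
move=> /(_ nmin); apply/negP; rewrite -ltNge.
apply: le_lt_trans (Y_super Ux1) _.
by rewrite -mulr_sumr -mulrBr mulr_gt0.
Unshelve. all: by end_near. Qed.

(** Hopf's argument: if noncontact points accumulate at [x], a contact point [z] nearest to one of
    them, [c], bounds a ball centred at [c] with no contact point inside, which [no_touching]
    excludes. *)
Lemma strong_maximum_principle x : U x -> dot (Y x) nu = lambda ->
  \forall y \near x, dot (Y y) nu = lambda.
Proof.
move=> Ux Yx; apply: contrapT => nZ.
have /nbhs_ballP[e /= e0 He] : \forall y \near x, U y by exact: open_nbhs_nbhs.
pose r := e / 2.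
have r0 : 0 < r by rewrite divr_gt0.
pose C : set 'rV[R]_n := [set y | `|x - y| <= r].
have CU y : C y -> U y.
  move=> Cy; apply: He; rewrite -ball_normE /=; apply: (le_lt_trans Cy).
  by rewrite /r ltr_pdivrMr// mulrDr mulr1 ltrDl.
have cdist := @continuous_norm_sub R n x.
have cC : compact C by exact: compact_closed_norm_ball.
have clC : closed C by exact: closed_closed_norm_ball.
have sqr_cont c : continuous (fun y : 'rV[R]_n => dot (y - c) (y - c)).
  move=> y; have cyc : t - c @[t --> y] --> y - c.
    exact (cvgB (@cvg_id _ (nbhs y)) (cvg_cst c)).
  exact (cvg_dot cyc cyc).
(* As [x] itself is a contact point, [z] is no farther from [c] than [x] is; the bound [r / 2] thus
   puts [z] in the interior of [C], and minimality over [Z] is local minimality among all contact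
   points. *)
have [c cx Yc] : exists2 c, dot (c - x) (c - x) < (r / 2) ^+ 2 & dot (Y c) nu != lambda.
  apply: contrapT => nc; apply: nZ.
  have : \forall y \near x, dot (y - x) (y - x) < (r / 2) ^+ 2.
    have cx := sqr_cont x x.
    by apply: cvgr_lt cx _ _; rewrite subrr dot0l exprn_gt0// divr_gt0.
  apply: filterS => y yx; apply/eqP; apply/negPn/negP => Yy; apply: nc.
  by exists y.
pose Z : set 'rV[R]_n := C `&` [set y | dot (Y y) nu = lambda].
have clZ : closed Z.
  move=> y clZy; have Cy : C y by apply: clC; apply: closureS clZy => t [].
  split=> //; apply: contrapT => /eqP Yy.
  have cYy : Y @ y --> Y y.
    by apply: differentiable_continuous; have [+ _] := cY; apply; exact: CU.
  have cd : dot (Y t) nu - lambda @[t --> y] --> dot (Y y) nu - lambda.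
    exact (cvgB (cvg_dot cYy (cvg_cst nu)) (cvg_cst (lambda : R))).
  have : \forall t \near y, dot (Y t) nu - lambda != 0.
    by apply: cvgr_neq0 cd _; rewrite subr_eq0.
  by move=> /clZy[t [[_ /= ->]]]; rewrite subrr eqxx.
have cZ : compact Z by apply: subclosed_compact clZ cC _ => t [].
have Zx : Z x by split=> //; rewrite /C /= subrr normr0 ltW.
have [||z /[1!inE] Zz zmin] :=
    @compact_EVT_min _ _ (fun y : 'rV[R]_n => dot (y - c) (y - c)) Z _ cZ.
- by exists x.
- by apply: continuous_in_subspaceT => y _; exact: sqr_cont.
have xz : `|x - z| < r.
  have xc : enorm (c - x) < r / 2.
    by rewrite -(@ltr_pXn2r _ 2)// ?nnegrE ?enorm_ge0 ?divr_ge0 ?ltW// sqr_enorm.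
  have zc : enorm (c - z) <= enorm (c - x).
    rewrite -(@ler_pXn2r _ 2)// ?nnegrE ?enorm_ge0// !sqr_enorm.
    rewrite -![c - _]opprB !dotNl !dotNr !opprK.
    exact: zmin (mem_set Zx).
  have -> : x - z = (c - z) - (c - x) by rewrite opprB [RHS]addrC addrA subrK.
  rewrite (le_lt_trans (ler_normB _ _))// [ltRHS]splitr.
  rewrite ltr_leD// ?(le_lt_trans (norm_le_enorm _))// ?(le_lt_trans zc)//.
  by rewrite (le_trans (norm_le_enorm _))// ltW.
have [Cz Yz] := Zz.
apply: (@no_touching c z) => //; first exact: CU.
  by apply: contra_neq Yc => ->.
have : \forall y \near z, `|x - y| < r by exact: cvgr_lt (cdist z) _ xz.
apply: filterS => y /ltW Cy Yy; apply: zmin; exact: mem_set.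
Qed.

End strong_maximum_principle.

(** * The global argument *)

(* The conclusion says that the drift Laplacian of <Y, nu> + eps |Y|^2 is
   nonnegative at x. *)
Lemma interior_min_sqr (R : realType) (n m : nat) (U : set 'rV[R]_n)
    (Y : 'rV[R]_n -> 'rV[R]_m) (x : 'rV[R]_n) (nu : 'rV[R]_m) (eps : R) :
  open U -> Ck_on 2 U Y -> U x -> row_free ('J Y x) ->
  (\forall y \near x, dot (Y x) nu + eps * dot (Y x) (Y x) <=
                      dot (Y y) nu + eps * dot (Y y) (Y y)) ->
  - (2 * eps * (n%:R + dot (weighted_mean_curvature_vector Y x - Y x) (Y x))) <=
  dot (weighted_mean_curvature_vector Y x - Y x) nu.
Proof.
move=> oU cY Ux rf xmin; have [dY d2Y] := cY.
have dYv v y : U y -> is_derive y v Y ('D_v Y y).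
  by move=> Uy; apply: derivableP; exact/diff_derivable/dY.
have ddYv v : is_derive x v ('D_v Y) ('D_v ('D_v Y) x).
  by apply: derivableP; apply: diff_derivable; have [+ _] := d2Y v; exact.
have d1 v y : U y -> is_derive y v (fun y => - eps * dot (Y y) (Y y))
    (- eps * (2 * dot ('D_v Y y) (Y y))).
  move=> Uy; have d := dYv v y Uy.
  apply: (is_derive_eq (is_deriveZ (- eps) (is_derive_dot d d))).
  by rewrite (dotC (Y y)) /GRing.scale/=; ring.
have d2 v : is_derive x v (fun y => - eps * (2 * dot ('D_v Y y) (Y y)))
    (- eps * (2 * (dot ('D_v ('D_v Y) x) (Y x) + dot ('D_v Y x) ('D_v Y x)))).
  apply: (is_derive_eq
    (is_deriveZ (- eps) (is_deriveZ 2 (is_derive_dot (ddYv v) (dYv v x Ux))))).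
  by rewrite /GRing.scale/=.
have := @interior_min _ _ _ U Y x nu (fun y => - eps * dot (Y y) (Y y))
  (fun v y => - eps * (2 * dot ('D_v Y y) (Y y)))
  (fun v => - eps * (2 * (dot ('D_v ('D_v Y) x) (Y x) + dot ('D_v Y x) ('D_v Y x))))
  oU cY Ux rf d1 d2.
have xmin' : \forall y \near x, dot (Y x) nu - - eps * dot (Y x) (Y x) <=
    dot (Y y) nu - - eps * dot (Y y) (Y y).
  by apply: filterS xmin => y; rewrite !mulNr !opprK.
move=> /(_ xmin'); apply: le_trans.
(* Summed over the frame, the second derivatives of [Y] give the trace Hessian and the squared first
   derivatives give [n]. *)
rewrite -mulr_sumr -mulr_sumr big_split/= -dot_suml (sum_derive2_frame oU cY Ux rf).
rewrite (sum_sqr_derive_frame (dY _ Ux) rf).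
rewrite [in leLHS](weighted_mean_curvature_drift (dY _ Ux)) addrAC addrK.
by rewrite dotDl dotNl le_eqVlt; apply/orP; left; apply/eqP; ring.
Qed.

(** The foot of the perpendicular from the origin attains the value, and Cauchy-Schwarz gives the
    lower bound. *)
Lemma edist_to_hyperplane (R : realType) (m : nat) (nu : 'rV[R]_m) (b : R) :
  nu != 0 -> edist_to 0 (hyperplane_of nu b) = `|b| / enorm nu.
Proof.
move=> nu0; have nn : 0 < dot nu nu by rewrite dotuu_gt0.
have en : 0 < enorm nu by rewrite sqrtr_gt0.
pose y0 := (b / dot nu nu) *: nu.
have Py0 : hyperplane_of nu b y0.
  by rewrite /hyperplane_of /= dotZl divfK// gt_eqF.
have Ey0 : enorm (0 - y0) = `|b| / enorm nu.
  apply/eqP; rewrite -(@eqrXn2 _ 2)// ?enorm_ge0 ?divr_ge0 ?enorm_ge0//.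
  rewrite exprMn exprVn !sqr_enorm sub0r dotNl dotNr opprK dotZl dotZr.
  by rewrite real_normK ?num_real//; apply/eqP; field; rewrite gt_eqF.
have lb : lbound [set enorm (0 - y) | y in hyperplane_of nu b] (`|b| / enorm nu).
  move=> _ [y /= <- <-]; rewrite ler_pdivrMr// sub0r enormN.
  exact: norm_dot_le_enorm.
apply/eqP; rewrite eq_le; apply/andP; split.
  rewrite -Ey0; apply: inf_lbound; last by exists y0.
  by exists (`|b| / enorm nu).
by apply: lb_le_inf => //; exists (enorm (0 - y0)); exists y0.
Qed.

Lemma halfspace_bound_ge0 (R : realType) (m : nat) (nu : 'rV[R]_m) (b : R) :
  ~ interior (halfspace_of nu b) 0 -> 0 <= b.
Proof.
move=> nint; rewrite leNgt; apply/negP => b0; apply: nint.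
have cd : dot y nu @[y --> (0 : 'rV[R]_m)] --> dot (0 : 'rV[R]_m) nu.
  exact (cvg_dot (@cvg_id _ (nbhs (0 : 'rV[R]_m))) (cvg_cst nu)).
have : \forall y \near (0 : 'rV[R]_m), b < dot y nu.
  by apply: cvgr_gt cd _ _; rewrite dot0l.
by apply: filterS => y /ltW.
Qed.

(** Here [r] and [w] stand for |F| and <F, nu>, [h1] and [h2] for the products of the weighted mean
    curvature vector with F and nu, [k] for the dimension. Nonnegativity of [w - lambda] forces
    [r ^+ 2 <= k + lambda * r], which bounds [r] independently of [eps]. *)
Lemma perturbed_min_bound (R : realType) (k eps lambda r h1 h2 w : R) :
  0 <= lambda -> 0 < eps -> 0 <= k -> 0 <= r -> lambda <= w ->
  h1 <= lambda * r -> h2 <= lambda ->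
  - (2 * eps * (k + (h1 - r ^+ 2))) <= h2 - w ->
  r <= k + lambda + 1 /\ w - lambda <= 2 * eps * (k + lambda * (k + lambda + 1)).
Proof.
move=> l0 e0 k0 r0 lw h1r h2l key.
have e2 : 0 < 2 * eps by rewrite mulr_gt0.
have le1 : w - lambda <= 2 * eps * (k + (lambda * r - r ^+ 2)).
  apply: (@le_trans _ _ (2 * eps * (k + (h1 - r ^+ 2)))).
    by rewrite -lerN2 (le_trans key)// opprB lerD2r.
  by rewrite ler_pM2l// lerD2l lerD2r.
have s0 : 0 <= k + (lambda * r - r ^+ 2).
  by rewrite -(pmulr_rge0 _ e2) (le_trans _ le1)// subr_ge0.
have rle : r <= k + lambda + 1.
  by rewrite leNgt; apply/negP => rr; move: s0; nra.
split=> //; apply: (le_trans le1); rewrite ler_pM2l// lerD2l.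
by have := ler_wpM2l l0 rle; nra.
Qed.

(** * Contact and noncontact sets on the submanifold *)

Section lambda_submanifold_in_halfspace.
Context {R : realType} {n m : nat} {lambda : R} {M : topologicalType}.
Variables (A : smooth_manifold_structure R n M) (F : M -> 'rV[R]_m).
Variable (nu : 'rV[R]_m).
Hypotheses (lambda_ge0 : 0 <= lambda) (himm : immersion A F).
Hypotheses (hproper : proper_map F) (hSigma : lambda_submanifold A F lambda).
Hypotheses (nu1 : enorm nu = 1) (F_ge : forall q, lambda <= dot (F q) nu).

Let open_cimg (c : chart R n M) : open (cimg c). Proof. exact: cimg_open. Qed.

Let local_param_C2 (c : chart R n M) : atlas A c -> Ck_on 2 (cimg c) (local_param c F).
Proof. by move=> Ac; have [+ _] := himm => /(_ c Ac); apply. Qed.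

Let local_param_row_free (c : chart R n M) x :
  atlas A c -> cimg c x -> row_free ('J (local_param c F) x).
Proof. by move=> Ac [q cq <-]; have [_] := himm; apply. Qed.

Let local_param_cmap (c : chart R n M) q : cdom c q -> local_param c F (cmap c q) = F q.
Proof. by move=> cq; rewrite /local_param /= cmapK. Qed.

Let near_cdom (c : chart R n M) q : cdom c q -> \forall r \near q, cdom c r.
Proof. by move=> cq; apply: open_nbhs_nbhs; split=> //; exact: cdom_open. Qed.

Lemma immersion_continuous : continuous F.
Proof.
move=> q; have [c Ac cq] := atlas_cover A q.
have Ux : cimg c (cmap c q) by exists q.
have cY : local_param c F @ cmap c q --> local_param c F (cmap c q).
  by apply: differentiable_continuous; have [+ _] := local_param_C2 Ac; exact.
have : local_param c F (cmap c r) @[r --> q] --> F q.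
  by rewrite -(local_param_cmap cq); exact: cvg_comp (cmap_continuous cq) cY.
apply: cvg_trans; apply: near_eq_cvg.
by apply: filterS (near_cdom cq) => r /local_param_cmap.
Qed.

Let dot_wmcv_le (c : chart R n M) x (u : 'rV[R]_m) : atlas A c -> cimg c x ->
  dot (weighted_mean_curvature_vector (local_param c F) x) u <= lambda * enorm u.
Proof. by move=> Ac [q cq <-]; rewrite -(hSigma Ac cq) dot_le_enorm. Qed.

(** In a chart the height is a supersolution, since <H_f, nu> is at most [lambda], hence at most the
    height; the strong maximum principle applies and the chart pulls the neighbourhood back. *)
Lemma open_contact_set : open [set q | dot (F q) nu = lambda].
Proof.
rewrite openE => q /= Fq; have [c Ac cq] := atlas_cover A q.
have Ux : cimg c (cmap c q) by exists q.
have near0 : \forall y \near cmap c q, dot (local_param c F y) nu = lambda.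
  apply: (@strong_maximum_principle _ _ _ (cimg c) (local_param c F) nu lambda).
  - exact: open_cimg.
  - exact: local_param_C2.
  - by move=> x; exact: local_param_row_free.
  - by move=> x _; exact: F_ge.
  - move=> x xc; rewrite dotDl dotNl subr_le0.
    by rewrite (le_trans (dot_wmcv_le nu Ac xc))// nu1 mulr1; exact: F_ge.
  - exact: Ux.
  - by rewrite local_param_cmap.
have := cmap_continuous cq near0; rewrite /= => nq.
by apply: filterS2 (near_cdom cq) nq => r cr Er; rewrite /= -(local_param_cmap cr).
Qed.

Lemma height_continuous : continuous (fun q => dot (F q) nu).
Proof. move=> q; exact (cvg_dot (immersion_continuous (x := q)) (cvg_cst nu)). Qed.

(** Closedness makes the part of the noncontact set lying over a ball compact; openness, proved
    next, makes a minimum over the noncontact set a local minimum on the whole manifold. *)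
Lemma closed_noncontact_set : closed [set q | dot (F q) nu != lambda].
Proof.
rewrite (_ : mkset _ = ~` [set q | dot (F q) nu = lambda]).
  by apply: open_closedC; exact: open_contact_set.
by apply/seteqP; split=> q /= /eqP.
Qed.

Lemma open_noncontact_set : open [set q | dot (F q) nu != lambda].
Proof.
rewrite (_ : mkset _ = ~` [set q | dot (F q) nu = lambda]).
  rewrite openC.
  exact: (closed_comp (fun q _ => height_continuous (x := q)) (@closed_eq _ lambda)).
by apply/seteqP; split=> q /= /eqP.
Qed.

Let radius : R := n%:R + lambda + 1.

(** The term [eps] |F|^2 is coercive because F is proper, so the perturbed height has a minimum on
    the noncontact set. What matters is that [radius] does not depend on [eps]. *)
Lemma perturbed_min q0 (eps : R) : dot (F q0) nu != lambda -> 0 < eps ->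
  exists q, [/\ dot (F q) nu != lambda, enorm (F q) <= radius &
    dot (F q) nu - lambda <= 2 * eps * (n%:R + lambda * radius)].
Proof.
move=> Nq0 eps0.
pose phi q := dot (F q) nu + eps * dot (F q) (F q).
pose N := [set q | dot (F q) nu != lambda].
have cF : continuous F := immersion_continuous.
have cphi : continuous phi.
  move=> q.
  exact (cvgD (height_continuous (x := q)) (cvgM (cvg_cst (eps : R)) (cvg_dot (cF q) (cF q)))).
have phi_ge q : eps * dot (F q) (F q) <= phi q.
  by rewrite lerDr (le_trans lambda_ge0).
have phi0 q : 0 <= phi q.
  by apply: le_trans (phi_ge q); apply: mulr_ge0; [exact: ltW|exact: dotuu_ge0].
(* Beyond [rho], which is at least 1, |F|^2 exceeds [rho - 1 = phi q0 / eps], so [phi] exceeds its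
   value at [q0]. *)
pose rho := 1 + phi q0 / eps.
have rho1 : 1 <= rho by rewrite lerDl divr_ge0// ltW.
have far q : rho < `|F q| -> phi q0 < phi q.
  move=> Fq; apply: lt_le_trans (phi_ge q).
  have h1 : rho < enorm (F q) by rewrite (lt_le_trans Fq)// norm_le_enorm.
  rewrite mulrC -ltr_pdivrMr// -sqr_enorm.
  have : phi q0 / eps = rho - 1 by rewrite /rho addrAC subrr add0r.
  by move=> ->; nra.
pose K := N `&` F @^-1` [set u | `|0 - u| <= rho].
have cK : compact K.
  rewrite /K setIC; apply: compact_closedI; last exact: closed_noncontact_set.
  by apply: hproper; exact: compact_closed_norm_ball.
have Kq0 : K q0.
  by split=> //=; rewrite sub0r normrN leNgt; apply/negP => /far; rewrite ltxx.
have [||q1 /[1!inE] Kq1 q1min] := @compact_EVT_min _ _ phi K _ cK.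
- by exists q0.
- by apply: continuous_in_subspaceT => q _; exact: cphi.
have {}q1min q : N q -> phi q1 <= phi q.
  move=> Nq; have [qr|qr] := leP `|F q| rho.
    by apply: q1min; rewrite inE; split=> //=; rewrite sub0r normrN.
  by rewrite (le_trans (q1min q0 (mem_set Kq0)))// ltW// far.
have [Nq1 _] := Kq1.
have [c Ac cq1] := atlas_cover A q1.
set Y := local_param c F; set x1 := cmap c q1.
have Ux1 : cimg c x1 by exists q1.
have YF : Y x1 = F q1 by exact: local_param_cmap.
have nmin : \forall y \near x1, dot (Y x1) nu + eps * dot (Y x1) (Y x1) <=
    dot (Y y) nu + eps * dot (Y y) (Y y).
  have nN : \forall q \near cinv c x1, N q.
    rewrite cmapK//; apply: open_nbhs_nbhs; split=> //.
    exact: open_noncontact_set.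
  have := cinv_continuous Ux1 nN; rewrite /= => nN'.
  have sub y : N (cinv c y) -> dot (F q1) nu + eps * dot (F q1) (F q1) <=
      dot (Y y) nu + eps * dot (Y y) (Y y) by exact: q1min.
  rewrite YF; exact (filterS sub nN').
have := interior_min_sqr (open_cimg (c := c)) (local_param_C2 Ac) Ux1
  (local_param_row_free Ac Ux1) nmin.
have := dot_wmcv_le nu Ac Ux1; rewrite nu1 mulr1.
have := dot_wmcv_le (F q1) Ac Ux1.
rewrite -/Y -/x1; move: (weighted_mean_curvature_vector Y x1) => W.
rewrite YF !dotDl !dotNl -sqr_enorm => h1 h2 key.
have [rle wle] := perturbed_min_bound lambda_ge0 eps0 (ler0n R n) (enorm_ge0 _)
  (F_ge q1) h1 h2 key.
by exists q1.
Qed.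

(** On the compact part of the noncontact set within [radius] the height gap has a positive minimum,
    whereas [perturbed_min] yields points there with arbitrarily small gap. *)
Lemma immersion_in_hyperplane q : dot (F q) nu = lambda.
Proof.
apply/eqP/negPn/negP => Nq.
pose K := [set q | dot (F q) nu != lambda] `&` F @^-1` [set u | `|0 - u| <= radius].
(* The value 1 of [eps] is arbitrary: the point only shows that [K] is nonempty. *)
have [q1 [Nq1 q1r _]] := perturbed_min Nq ltr01.
have inK r : dot (F r) nu != lambda -> enorm (F r) <= radius -> K r.
  by move=> Nr rr; split=> //=; rewrite sub0r normrN (le_trans (norm_le_enorm _)).
have cK : compact K.
  rewrite /K setIC; apply: compact_closedI; last exact: closed_noncontact_set.
  by apply: hproper; exact: compact_closed_norm_ball.
have [||q2 /[1!inE] Kq2 q2min] := @compact_EVT_min _ _ (fun q => dot (F q) nu) K _ cK.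
- by exists q1; exact: inK.
- by apply: continuous_in_subspaceT => r _; exact: height_continuous.
have w2 : 0 < dot (F q2) nu - lambda.
  by case: Kq2 => Nq2 _; rewrite subr_gt0 lt_neqAle eq_sym Nq2 F_ge.
have radius_ge0 : 0 <= radius by rewrite /radius !addr_ge0.
(* For [eps] equal to the minimal gap divided by [D], the new point has gap at most [eps * (D - 1)],
   below the minimum [eps * D]. *)
pose D := 2 * (n%:R + lambda * radius) + 1.
have D0 : 0 < D by rewrite ltr_wpDl// mulr_ge0// addr_ge0// mulr_ge0.
have eps0 : 0 < (dot (F q2) nu - lambda) / D by rewrite divr_gt0.
have [q3 [Nq3 q3r]] := perturbed_min Nq eps0.
have := q2min q3 (mem_set (inK _ Nq3 q3r)).
set eps := _ / D in eps0 *; have E : dot (F q2) nu - lambda = eps * D.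
  by rewrite /eps divfK// gt_eqF.
by move: E eps0; rewrite /D; lra.
Qed.

End lambda_submanifold_in_halfspace.

Theorem theorem6 (R : realType) (n p : nat) (hn : (1 <= n)%N) (hp : (1 <= p)%N)
  (lambda : R) (hlambda : 0 <= lambda)
  (M : topologicalType) (A : smooth_manifold_structure R n M)
  (F : M -> 'rV[R]_(n + p))
  (himm : immersion A F) (hproper : proper_map F)
  (hcomplete : complete_immersed A F)
  (hSigma : lambda_submanifold A F lambda)
  (P : set 'rV[R]_(n + p)) (hP : is_hyperplane P)
  (hdist : edist_to 0 P = lambda)
  (S : set 'rV[R]_(n + p)) (hS : closed_halfspace_bounded_by S P)
  (hO : ~ interior S 0)
  (hside : range F `<=` S) :
  range F `<=` P.
Proof.
have [nu [b [nu0 PE SE]]] := hS; subst P S.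
(* The position of the origin fixes the sign of [b], so the distance [lambda] is [b / enorm nu], and
   after normalising [nu] the half-space is the set where the height is at least [lambda]. *)
have b0 := halfspace_bound_ge0 hO.
have en : 0 < enorm nu by rewrite sqrtr_gt0 dotuu_gt0.
move: hdist; rewrite edist_to_hyperplane// ger0_norm// => lambdaE.
have dotE' u : dot u ((enorm nu)^-1 *: nu) = dot u nu / enorm nu.
  by rewrite dotZr mulrC.
move=> _ [q _ <-].
have := @immersion_in_hyperplane _ _ _ _ _ A F ((enorm nu)^-1 *: nu) hlambda himm
  hproper hSigma.
have -> : enorm ((enorm nu)^-1 *: nu) = 1.
  apply/eqP; rewrite -(@eqrXn2 _ 2)// ?enorm_ge0// sqr_enorm dotZl dotZr.
  by rewrite -sqr_enorm expr1n; apply/eqP; field; rewrite gt_eqF.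
move=> /(_ erefl) inP.
have {inP}/inP /(_ q) : forall q, lambda <= dot (F q) ((enorm nu)^-1 *: nu).
  move=> r; rewrite dotE' -lambdaE ler_pM2r ?invr_gt0//.
  by apply: hside; exists r.
rewrite dotE' -lambdaE => E; rewrite /hyperplane_of /=; apply: (mulIf _ E).
by rewrite invr_neq0// gt_eqF.
Qed.
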